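(* Let $P=(V,\le)$ be an interval order without infinite antichains. The following are equivalent: (i) $P$ is scattered; (ii) the chain $AM(P)_{\le}$ of maximal antichains of $P$ is scattered; (iii) the chain $(\{U(x):x\in V\},\subseteq)$ is scattered; (iv) the chain $(\{D(x):x\in V\},\subseteq)$ is scattered; (v) $P$ is isomorphic to a collection of nonempty intervals of some scattered chain (ordered by $I<J$ iff every element of $I$ is below every element of $J$).
   Context: A poset $P$ is an interval order if it is isomorphic to a set of nonempty intervals of some chain $C$, ordered by $I<J$ iff $x<y$ for all $x\in I$, $y\in J$. A poset is scattered if it does not embed the chain $\mathbb{Q}$ of rational numbers. $AM(P)$ is the set of maximal antichains of $P$, ordered by $A\le B$ iff for every $a\in A$ there is $b\in B$ with $a\le b$ (for an interval order this is a chain). For $x\in V$, $D(x)=\{y: y<x\}$ and $U(x)=\{y:y>x\}$. *)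

(* Defs.v *)
From mathcomp Require Import all_boot all_order all_algebra.
From mathcomp Require Import boolp classical_sets functions cardinality.

Set Implicit Arguments.
Unset Strict Implicit.
Unset Printing Implicit Defensive.

Import Order.TTheory.

Local Open Scope classical_set_scope.
Local Open Scope order_scope.

(* [R] is meant to be a partial order on [A].  A map [f] satisfying the
   equivalence below is automatically injective, since [<=] is antisymmetric
   on [rat]. *)
Definition embeds_rat (X : Type) (A : set X) (R : X -> X -> Prop) : Prop :=
  exists f : rat -> X,
    (forall q, A (f q)) /\ (forall p q : rat, p <= q <-> R (f p) (f q)).

Definition scattered (X : Type) (A : set X) (R : X -> X -> Prop) : Prop :=
  ~ embeds_rat A R.

Definition scattered_poset (d : Order.disp_t) (T : porderType d) : Prop :=
  scattered [set: T] (fun x y => x <= y).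

Definition antichain (d : Order.disp_t) (T : porderType d) (A : set T) : Prop :=
  forall x y, A x -> A y -> x != y -> x >< y.

(* Maximality is with respect to inclusion. *)
Definition AM (d : Order.disp_t) (T : porderType d) : set (set T) :=
  [set A | antichain A /\ forall B, antichain B -> A `<=` B -> B = A].
Arguments AM {d} T _.

Definition AM_le (d : Order.disp_t) (T : porderType d) (A B : set T) : Prop :=
  forall a, A a -> exists2 b, B b & a <= b.

Definition upset (d : Order.disp_t) (T : porderType d) (x : T) : set T :=
  [set y | x < y].

Definition downset (d : Order.disp_t) (T : porderType d) (x : T) : set T :=
  [set y | y < x].

(* Intervals are arbitrary order-convex subsets: they need not have endpoints
   in the chain, so the library type [interval C] would be too restrictive. *)
Definition chain_interval (d : Order.disp_t) (C : orderType d) (I : set C) :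
    Prop :=
  forall x y, I x -> I y -> forall z, x <= z <= y -> I z.

Definition interval_lt (d : Order.disp_t) (C : orderType d) (I J : set C) :
    Prop :=
  forall x y, I x -> J y -> x < y.

Definition interval_representable (d : Order.disp_t) (T : porderType d)
    (d' : Order.disp_t) (C : orderType d') : Prop :=
  exists S : set (set C),
    (forall I, S I -> I !=set0 /\ chain_interval I) /\
    exists f : T -> set C,
      set_bij [set: T] S f /\ (forall x y, x < y <-> interval_lt (f x) (f y)).

Definition interval_order (d : Order.disp_t) (T : porderType d) : Prop :=
  exists (d' : Order.disp_t) (C : orderType d'), interval_representable T C.

(* Main.v *)
(** The engine is the absence of [2+2]: [x < z] and [w < y] force [x < y] or
    [w < z].

    (i) => (ii): let [q |-> A q] embed the rationals in [AM P].  An element common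
    to [A p] and [A r] lies in every [A q] with [p <= q <= r], so [A p `&` A r]
    grows as [(p, r)] shrinks.  It cannot grow forever, as the union would be an
    infinite antichain; hence on some [(p, r)] all pairwise intersections equal one
    set [F].  Any choice of [x q] in [A q] outside [F] is then strictly increasing:
    for [q < t < s], [x q] is below some element of [A t] and [x s] above another.

    (ii) => (iii) => (iv): a rational family of up- (down-) sets is read on disjoint
    rational intervals [(f p, g p)], increasing with [p]; an element separating the
    sets at [f p] and [g p] yields an antichain (an up-set) attached to [p].

    (iv) => (v): [P] itself is ordered linearly by inclusion of down-sets, ties being
    finite antichains broken arbitrarily; [x] is represented by the interval of all
    [y] above it in this chain but not in [P]. *)
Require Import Defs.
From mathcomp Require Import all_boot all_order all_algebra.
From HB Require Import structures.
From mathcomp Require Import boolp classical_sets functions cardinality.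

Set Implicit Arguments.
Unset Strict Implicit.
Unset Printing Implicit Defensive.

Import Order.TTheory GRing.Theory Num.Theory.

Local Open Scope order_scope.
Local Open Scope classical_set_scope.

(** * Copies of the rationals inside dense transitive relations *)

Section Cantor.
Variables (X : choiceType) (lt : rel X).
Hypothesis lt_trans : transitive lt.
Hypothesis lt_dense : forall x y, lt x y -> exists2 z, lt x z & lt z y.

Let lt_pair (e e' : rat * X) := (e.1 < e'.1) && lt e.2 e'.2.
Let between a b (s : seq (rat * X)) := all (fun e => lt a e.2 && lt e.2 b) s.

(** Induction on [s], raising the lower bound [a] to the value at the head. The last clause says
    that [q] is the only new key, so the key of the head stays below those of the new tail. *)
Let insert a b (s : seq (rat * X)) (q : rat) :
    lt a b -> between a b s -> pairwise lt_pair s ->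
  exists s', [/\ between a b s', pairwise lt_pair s', {subset s <= s'},
    q \in unzip1 s' & forall e, e \in s' -> e \in s \/ e.1 = q].
Proof.
elim: s a => [|[p x] s IHs] a ab.
  move=> _ _; have [z az zb] := lt_dense ab.
  exists [:: (q, z)]; split; rewrite ?inE //=; first by rewrite az zb.
  by move=> e; rewrite inE => /eqP ->; right.
move=> /=/andP[/andP[ax xb] bs] /andP[xs ss].
have [qp|pq|qp] := ltgtP q p; last 1 first.
- exists ((p, x) :: s); split=> //=; rewrite ?inE ?qp ?eqxx ?ax ?xb ?xs ?ss //=.
  by move=> e; left.
- have [z az zx] := lt_dense ax.
  exists [:: (q, z), (p, x) & s]; split=> /=.
  + by rewrite az ax xb (lt_trans zx xb).
  + rewrite /lt_pair /= qp zx xs ss !andbT /=; apply/allP => e /(allP xs) /andP[/= pe xe].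
    by rewrite (Order.POrderTheory.lt_trans qp pe) (lt_trans zx xe).
  + by move=> e; rewrite [in X in _ -> X]inE orbC => ->.
  + by rewrite inE eqxx.
  + by move=> e; rewrite inE => /orP[/eqP ->|]; [right|left].
have bxs : between x b s.
  apply/allP => e es; move/allP: bs => /(_ _ es)/andP[_ ->].
  by move/allP: xs => /(_ _ es)/andP[_ ->].
have [s' [bs' ss' sub qs' news']] := IHs x xb bxs ss.
exists ((p, x) :: s'); split=> /=; last 3 first.
- by move=> e; rewrite !inE => /orP[->|/sub ->]; rewrite ?orbT.
- by rewrite inE qs' orbT.
- move=> e; rewrite !inE => /orP[->|/news'[->|]]; rewrite ?orbT; by [left|right].
- rewrite ax xb /=; apply/allP => e /(allP bs')/andP[xe ->].
  by rewrite (lt_trans ax xe).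
- rewrite ss' andbT; apply/allP => e es'.
  have /andP[xe _] := allP bs' _ es'; rewrite /lt_pair /= xe andbT.
  by have [/(allP xs)/andP[]|->] := news' _ es'.
Qed.

Let lt_pair_sorted s e e' : pairwise lt_pair s ->
  e \in s -> e' \in s -> e.1 < e'.1 -> lt e.2 e'.2.
Proof.
elim: s => //= y s IHs /andP[/allP ys ss]; rewrite !inE.
move=> /orP[/eqP->|es] /orP[/eqP->|es'] lt1.
- by rewrite ltxx in lt1.
- by have /andP[] := ys _ es'.
- by have /andP[/(Order.POrderTheory.lt_trans lt1)] := ys _ es; rewrite ltxx.
- exact: IHs.
Qed.

(** The forth half of Cantor's back-and-forth: finite increasing partial maps absorb the rationals
    one by one, in the order of their codes, and [f] is read off their union. *)
Lemma dense_embeds_rat a b : lt a b ->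
  exists f : rat -> X, forall p q, p < q -> lt (f p) (f q).
Proof.
move=> ab.
pose ok s := between a b s && pairwise lt_pair s.
have step (ns : nat * {s | ok s}) : {ms : nat * {s | ok s} |
    [/\ ms.1 = ns.1.+1, {subset val ns.2 <= val ms.2} &
     forall q, unpickle ns.1 = Some q -> q \in unzip1 (val ms.2)]}.
  apply: cid; case: ns => n [s oks] /=; have /andP[bs ss] := oks.
  (* If [n] codes no rational, 0 is inserted, which is harmless. *)
  have [s' [bs' ss' sub qs' _]] := insert (odflt 0%R (unpickle n)) ab bs ss.
  have oks' : ok s' by rewrite /ok bs' ss'.
  by exists (n.+1, exist _ s' oks'); split=> //= q nq; move: qs'; rewrite nq.
have [S [S0 SS]] := dependent_choice step (0%N, exist ok [::] isT).
have S1 n : (S n).1 = n.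
  by elim: n => [|n IHn]; [rewrite S0|have [-> _ _] := SS n; rewrite IHn].
have Smono m n : (m <= n)%N -> {subset val (S m).2 <= val (S n).2}.
  elim: n => [|n IHn]; first by rewrite leqn0 => /eqP ->.
  rewrite leq_eqVlt => /orP[/eqP->//|]; rewrite ltnS => /IHn mn e /mn.
  by have [_ sub _] := SS n; apply: sub.
have fP q : exists x, (q, x) \in val (S (pickle q).+1).2.
  have [_ _] := SS (pickle q); rewrite S1 pickleK => /(_ _ erefl)/mapP[[p x]].
  by move=> pxS qp; exists x; rewrite {1}qp; exact: pxS.
have [f {}fP] := choice fP.
exists f => p q pq.
have /andP[_ sorted_n] := valP (S (maxn (pickle p).+1 (pickle q).+1)).2.
apply: (@lt_pair_sorted _ (p, f p) (q, f q) sorted_n) => //.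
  exact: Smono (leq_maxl _ _) _ (fP p).
exact: Smono (leq_maxr _ _) _ (fP q).
Qed.

End Cantor.

Lemma rat_dense (p q : rat) : p < q -> exists2 r, p < r & r < q.
Proof. by move=> /midf_lt[]; exists ((p + q) / 2%:R)%R. Qed.

Lemma rat_embeds_itv (a b : rat) : a < b ->
  exists2 f : rat -> rat, forall p, a <= f p <= b & {homo f : p q / p < q}.
Proof.
move=> ab; pose R (p q : rat) := [&& a <= p, p < q & q <= b].
have [|||f fP] := @dense_embeds_rat _ R _ _ a b.
- move=> y x z /and3P[ax xy _] /and3P[_ yz zb].
  by rewrite /R ax (lt_trans xy yz).
- move=> x y /and3P[ax /rat_dense[z xz zy] yb]; exists z.
    by rewrite /R ax xz (le_trans (ltW zy) yb).
  by rewrite /R zy yb (le_trans ax (ltW xz)).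
- by rewrite /R ab !lexx.
exists f => [p|p q /fP/and3P[]//].
(* [R] bounds the members of a related pair only, so [p] is compared with [p - 1] and with
   [p + 1]. *)
have /fP/and3P[_ _ ->] : (p - 1 < p)%R by rewrite ltrBlDr ltrDl.
by have /fP/and3P[-> _ _] : (p < p + 1)%R by rewrite ltrDl.
Qed.

Lemma rat_split : exists f g : rat -> rat,
  (forall p, f p < g p) /\ (forall p q, p < q -> g p < f q).
Proof.
(* A pair stands for a nondegenerate interval and [R] puts one wholly before another; density holds
   because a third one fits in the gap. *)
pose R (u v : rat * rat) := [&& u.1 < u.2, u.2 < v.1 & v.1 < v.2].
have [|||h hP] := @dense_embeds_rat _ R _ _ (0, 1)%R (2%:R, 3%:R)%R.
- move=> v u w /and3P[u12 uv v12] /and3P[_ vw w12].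
  by rewrite /R u12 w12 (lt_trans uv (lt_trans v12 vw)).
- move=> u v /and3P[u12 /rat_dense[r ur rv] v12].
  by have [s rs sv] := rat_dense rv; exists (r, s); rewrite /R /= ?u12 ?ur ?rs ?sv.
- by [].
exists (fun p => (h p).1), (fun p => (h p).2); split=> [p|p q /hP/and3P[]//].
by have /hP/and3P[] : (p < p + 1)%R by rewrite ltrDl.
Qed.

Lemma strict_embeds_rat (X : Type) (A : set X) (R : X -> X -> Prop)
    (f : rat -> X) : (forall x, A x -> R x x) -> (forall q, A (f q)) ->
  (forall p q, p < q -> R (f p) (f q) /\ ~ R (f q) (f p)) -> embeds_rat A R.
Proof.
move=> Rxx Af fR; exists f; split=> // p q; split.
  by rewrite le_eqVlt => /orP[/eqP ->|/fR[]//]; apply: Rxx.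
by move=> Rpq; rewrite leNgt; apply/negP => /fR[].
Qed.

Lemma embeds_rat_strict (X : Type) (A : set X) (R : X -> X -> Prop) :
  embeds_rat A R -> exists f : rat -> X, (forall q, A (f q)) /\
    (forall p q, p < q -> R (f p) (f q) /\ ~ R (f q) (f p)).
Proof.
move=> [f [Af fR]]; exists f; split=> // p q pq; split; first exact/fR/ltW.
by move/fR; rewrite leNgt pq.
Qed.

Section OrderedBy.
Variables (T : choiceType) (le : rel T).
Hypotheses (le_anti : antisymmetric le) (le_trans : transitive le).
Hypothesis le_total : total le.

Let le_refl : reflexive le. Proof. by move=> x; have := le_total x x; rewrite orbb. Qed.

(* The proofs are arguments so that instance resolution can recover the order
   from the type. *)
Definition ordered_by (_ : antisymmetric le) (_ : transitive le)
  (_ : total le) : Type := T.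

Let O := ordered_by le_anti le_trans le_total.

HB.instance Definition _ := Choice.copy O T.
HB.instance Definition _ :=
  Order.Le_isPOrder.Build (Order.Disp tt tt) O le_refl le_anti le_trans.
HB.instance Definition _ :=
  Order.POrder_isTotal.Build (Order.Disp tt tt) O le_total.

End OrderedBy.

(** * Maximal antichains and the implications between the five conditions *)

Section IntervalOrder.
Variables (d : Order.disp_t) (P : porderType d).
Implicit Types (x y z w : P) (A B C : set P).

(** Choosing a point in each interval carries a copy of the rationals from [P] to [C]. *)
Lemma interval_representable_scattered (d' : Order.disp_t) (C : orderType d') :
  scattered_poset C -> interval_representable P C -> scattered_poset P.
Proof.
move=> Cscat [S [Sitv [I [[IS _ _] Ilt]]]] [f [_ fP]]; apply: Cscat.
have Ine q : exists c, I (f q) c by have [] := Sitv _ (IS (f q) Logic.I).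
have [c cP] := choice Ine.
apply: (@strict_embeds_rat _ _ _ c) => // p q pq.
have cpq : c p < c q.
  apply: (Ilt (f p) (f q)).1 (cP p) (cP q).
  rewrite lt_leAnge; apply/andP; split; first exact/fP/ltW.
  by apply/negP => /fP; rewrite leNgt pq.
by split; [exact: ltW|rewrite leNgt cpq].
Qed.

Lemma antichain_eq A x y : antichain A -> A x -> A y -> x <= y -> x = y.
Proof.
move=> Aanti Ax Ay xy; apply/eqP/negP => /negP/(Aanti _ _ Ax Ay).
by rewrite /Order.comparable xy.
Qed.

Lemma antichain_nlt A x y : antichain A -> A x -> A y -> ~ x < y.
Proof.
move=> Aanti Ax Ay xy; move: (xy).
by rewrite (antichain_eq Aanti Ax Ay (ltW xy)) ltxx.
Qed.

Lemma AM_comparable A x : AM P A -> exists2 a, A a & x >=< a.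
Proof.
move=> [Aanti Amax]; apply: contrapT => noA.
have xA a : A a -> x >< a by move=> Aa; apply/negP => xa; apply: noA; exists a.
have Ax : A x.
  suff <- : x |` A = A by left.
  apply: Amax => [y z [->|Ay] [->|Az] // yz|y]; last by right.
  - by rewrite eqxx in yz.
  - exact: xA.
  - by rewrite comparable_sym; exact: xA.
  - exact: Aanti.
by apply: noA; exists x; rewrite ?comparablexx.
Qed.

Lemma antichain_sub_AM A : antichain A -> exists2 B, AM P B & A `<=` B.
Proof.
(* Zorn is applied to the part [X] added to [A], so that the empty chain, whose union is empty, is
   no special case. *)
move=> Aanti; pose ext := [set X : set P | antichain (A `|` X)].
have [|X [extX Xmax]] := @Zorn_bigcup P ext.
  move=> F Fext Ftot x y [Ax|[X FX Xx]] [Ay|[Y FY Yy]].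
  - exact: Aanti.
  - by apply: (Fext _ FY); [left|right].
  - by apply: (Fext _ FX); [right|left].
  - have [XY|YX] := Ftot _ _ FX FY.
      by apply: (Fext _ FY); right => //; exact: XY.
    by apply: (Fext _ FX); right => //; exact: YX.
exists (A `|` X); last by move=> x; left.
split=> // B Banti AXB; apply/seteqP; split=> // x Bx.
right; apply: contrapT => Xx; apply: (Xmax B).
  by split=> [y Xy|BX]; [apply: AXB; right|apply/Xx/BX].
have AB : A `|` B = B by apply/setUidPr => y Ay; apply: AXB; left.
by rewrite /ext /= AB.
Qed.

Lemma AM_le_refl A : AM_le A A.
Proof. by move=> a Aa; exists a. Qed.

(** If the element of [A] comparable to [b] lies above [b], it also lies below some element of [B],
    which can only be [b]. *)
Lemma AM_le_dual A B b : AM P A -> antichain B -> AM_le A B -> B b ->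
  exists2 a, A a & a <= b.
Proof.
move=> AMA Banti AB Bb; have [a Aa /orP[ba|ab]] := AM_comparable b AMA; last first.
  by exists a.
exists a => //; have [c Bc ac] := AB _ Aa.
by rewrite (antichain_eq Banti Bb Bc (le_trans ba ac)).
Qed.

Lemma AM_le_convex A B C : AM_le A B -> AM_le B C -> antichain C ->
  A `&` C `<=` B.
Proof.
move=> AB BC Canti x [Ax Cx].
have [b Bb xb] := AB _ Ax; have [c Cc bc] := BC _ Bb.
have xc := antichain_eq Canti Cx Cc (le_trans xb bc).
by rewrite (_ : x = b)//; apply/le_anti; rewrite xb xc.
Qed.

Hypothesis antichain_finite : forall A, antichain A -> finite_set A.

(** Otherwise the union would be an antichain gaining a new element at every stage, hence
    infinite. *)
Lemma antichain_acc (F : nat -> set P) : (forall n, antichain (F n)) ->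
  ~ forall n, F n `<` F n.+1.
Proof.
move=> Fanti Flt.
have Fmono m n : (m <= n)%N -> F m `<=` F n.
  elim: n => [|n IHn]; first by rewrite leqn0 => /eqP ->.
  rewrite leq_eqVlt => /orP[/eqP->//|]; rewrite ltnS => /IHn mn.
  exact: subset_trans mn (Flt n).1.
have /choice[y yP] : forall n, exists x, F n.+1 x /\ ~ F n x.
  move=> n; apply: contrapT => noy; have [_ nsub] := Flt n.
  by apply: nsub => x Fx; apply: contrapT => Fnx; apply: noy; exists x.
pose U := \bigcup_n F n.
have Uanti : antichain U.
  move=> x z [m _ Fx] [n _ Fz]; apply: (Fanti (maxn m n)).
    exact: Fmono (leq_maxl _ _) _ Fx.
  exact: Fmono (leq_maxr _ _) _ Fz.
have yneq m n : (m < n)%N -> y m <> y n.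
  move=> mn ymn; apply: (yP n).2; rewrite -ymn.
  exact: Fmono mn _ (yP m).1.
have yinj : injective y.
  by move=> m n; have [/yneq//|/yneq + /esym//|] := ltngtP m n.
apply: infinite_nat; suff <- : y @^-1` U = [set: nat].
  by apply: finite_preimage (antichain_finite Uanti) => ? ? _ _ /yinj.
by apply/seteqP; split=> // n _; exists n.+1 => //; have [] := yP n.
Qed.


(** * Consequences of excluding [2+2] *)

Hypothesis no_2p2 : forall x y z w, x < z -> w < y -> x < y \/ w < z.

Lemma poset_scattered_AM : scattered_poset P -> scattered (AM P) (@AM_le d P).
Proof.
move=> Pscat [A [AMA Ale]]; apply: Pscat.
have Aanti q : antichain (A q) by have [] := AMA q.
have [p [r [pr stab]]] : exists p r, p < r /\ forall p' r',
    p <= p' -> p' < r' -> r' <= r -> A p' `&` A r' `<=` A p `&` A r.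
  apply: contrapT => nostab.
  pose S := {u : rat * rat | u.1 < u.2}; pose F (u : S) := A (val u).1 `&` A (val u).2.
  have step (u : S) : {v : S | F u `<` F v}.
    apply: cid; case: u => -[p r] /= pr; apply: contrapT => nov.
    apply: nostab; exists p, r; split=> // p' r' pp' pr' rr'.
    apply: contrapT => nsub; apply: nov; exists (exist _ (p', r') pr').
    split=> //= x [Ap Ar]; split.
      by apply: AM_le_convex (conj Ap Ar) => //; apply/Ale; rewrite ?(le_trans (ltW pr')).
    by apply: AM_le_convex (conj Ap Ar) => //; apply/Ale; rewrite ?(le_trans pp' (ltW pr')).
  have [u [_ uF]] := dependent_choice step (exist _ (0, 1)%R isT).
  by apply: (@antichain_acc (F \o u)) => // n x y [Ax _] [Ay _]; apply: (Aanti (val (u n)).1).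
set F := A p `&` A r in stab.
have [g gitv ghomo] := rat_embeds_itv pr.
have stabg q s x : q < s -> A (g q) x -> A (g s) x -> F x.
  move=> qs Aq As; have /andP[pq _] := gitv q; have /andP[_ sr] := gitv s.
  by apply: (stab (g q) (g s)) => //; exact: ghomo.
(* Were [A (g q)] contained in [F], it would lie in both [A p] and [A r], and maximality would make
   all three equal. *)
have /choice[x xP] : forall q, exists x, A (g q) x /\ ~ F x.
  move=> q; apply: contrapT => nox.
  have AF : A (g q) `<=` F.
    by move=> x Ax; apply: contrapT => Fx; apply: nox; exists x.
  have Aeq s : A (g q) `<=` A s -> A s = A (g q).
    by move=> sub; case: (AMA (g q)) => _; apply.
  have Ap : A p = A (g q) by apply: Aeq => y /AF[].
  have Ar : A r = A (g q) by apply: Aeq => y /AF[].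
  have : AM_le (A r) (A p) by rewrite Ap Ar; exact: AM_le_refl.
  by move/Ale; rewrite leNgt pr.
apply: (@strict_embeds_rat _ _ _ x) => // q s qs.
suff xqs : x q < x s by split=> [|/(lt_le_trans xqs)]; [exact: ltW|rewrite ltxx].
have [t qt ts] := rat_dense qs.
have [z Atz xz] : exists2 z, A (g t) z & x q <= z.
  by apply: (Ale (g q) (g t)).1 (xP q).1; exact/ltW/ghomo.
have [w Atw wx] : exists2 w, A (g t) w & w <= x s.
  apply: AM_le_dual (xP s).1 => //; exact/Ale/ltW/ghomo.
(* Equality would put [x q] in both [A (g q)] and [A (g t)], hence in [F]. *)
have {}xz : x q < z.
  rewrite lt_neqAle xz andbT; apply/eqP => xqz; apply: (xP q).2.
  by apply: stabg qt (xP q).1 _; rewrite xqz.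
have {}wx : w < x s.
  rewrite lt_neqAle wx andbT; apply/eqP => wxs; apply: (xP s).2.
  by apply: stabg ts _ (xP s).1; rewrite -wxs.
have [//|wz] := no_2p2 xz wx; case: (antichain_nlt (Aanti _) Atw Atz wz).
Qed.

Lemma AM_scattered_upset :
  scattered (AM P) (@AM_le d P) -> scattered (range (@upset d P)) (@subset P).
Proof.
move=> AMscat /embeds_rat_strict[U [Urange Ult]]; apply: AMscat.
have /choice[x xU] : forall q, exists x, upset x = U q.
  by move=> q; have [x _ <-] := Urange q; exists x.
have xlt p q : p < q -> upset (x p) `<=` upset (x q) /\ ~ upset (x q) `<=` upset (x p).
  by rewrite !xU; exact: Ult.
have [f [g [fg gf]]] := rat_split.
have /choice[A AP] : forall p, exists A, [/\ AM P A, A (x (f p)) &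
    exists2 y, A y & x (g p) < y].
  move=> p; have [_ /existsNP[y /not_implyP[/= xgy xfy]]] := xlt _ _ (fg p).
  (* [y] is not above [x (f p)]: if comparable, it is below or equal, and [x (f p)] itself lies
     above [x (g p)]; if not, the two form an antichain. *)
  have [yx|yx] := boolP (y >=< x (f p)).
    have [] := @antichain_sub_AM [set x (f p)].
      by move=> _ _ -> ->; rewrite eqxx.
    move=> A AMA subA; exists A; split=> //; first exact: subA.
    exists (x (f p)); first exact: subA.
    move: yx => /orP[yx|]; first exact: lt_le_trans yx.
    by rewrite le_eqVlt => /orP[/eqP xy|/xfy//]; rewrite xy.
  have [] := @antichain_sub_AM [set x (f p); y].
    move=> _ _ [->|->] [->|->] //; rewrite ?eqxx//.
    by rewrite comparable_sym.
  move=> A AMA subA; exists A; split=> //; first by apply: subA; left.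
  by exists y => //; apply: subA; right.
(* Up-sets grow as points descend, so the sign reverses the order. *)
apply: (@strict_embeds_rat _ _ _ (fun q => A (- q)%R)).
- by move=> B _; exact: AM_le_refl.
- by move=> q; have [] := AP (- q)%R.
move=> s r; rewrite -ltrN2; move: (- s)%R (- r)%R => {}s {}r rs.
have [AMr _ [y Ary xy]] := AP r; have [AMs Asx [y' Asy xy']] := AP s.
have {}xy : x (f s) < y by apply: (xlt (g r) (f s) _).1 xy; exact: gf.
have Aanti := (proj1 AMr); split; last first.
  move=> /(_ _ Ary)[b Asb yb].
  exact: antichain_nlt (proj1 AMs) Asx Asb (lt_le_trans xy yb).
move=> a Asa; have [b Arb /orP[ab|]] := AM_comparable a AMr; first by exists b.
rewrite le_eqVlt => /orP[/eqP ba|ba]; first by exists b; rewrite // ba.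
(* Either outcome puts a strict inequality inside an antichain: the first in [A s], the second in
   [A r]. *)
have [xa|byy] := no_2p2 xy ba.
  by case: (antichain_nlt (proj1 AMs) Asx Asa xa).
by case: (antichain_nlt Aanti Arb Ary byy).
Qed.

Lemma upset_scattered_downset :
  scattered (range (@upset d P)) (@subset P) ->
  scattered (range (@downset d P)) (@subset P).
Proof.
move=> Uscat /embeds_rat_strict[D [Drange Dlt]]; apply: Uscat.
have /choice[x xD] : forall q, exists x, downset x = D q.
  by move=> q; have [x _ <-] := Drange q; exists x.
have xlt p q : p < q ->
    downset (x p) `<=` downset (x q) /\ ~ downset (x q) `<=` downset (x p).
  by rewrite !xD; exact: Dlt.
have [f [g [fg gf]]] := rat_split.
have /choice[y yP] : forall p, exists y, y < x (g p) /\ ~ y < x (f p).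
  move=> p; have [_ /existsNP[y /not_implyP yP]] := xlt _ _ (fg p).
  by exists y.
apply: (@strict_embeds_rat _ _ _ (fun q => upset (y (- q)%R))) => [? _ ?|q|s r] //.
rewrite -ltrN2; move: (- s)%R (- r)%R => {}s {}r rs.
(* [x (f s)] is above [y r] but not above [y s]: it separates the two up-sets, and by [no_2p2] it
   forces the inclusion. *)
have yx : y r < x (f s) by apply: (xlt (g r) (f s) _).1 (yP r).1; exact: gf.
split=> [z yz|sub]; last exact/(yP s).2/sub.
by have [//|/(yP s).2] := no_2p2 yx yz.
Qed.


Lemma downset_total x y : downset x `<=` downset y \/ downset y `<=` downset x.
Proof.
apply: contrapT => /not_orP[/existsNP[z /not_implyP[/= zx zy]]].
case=> w wy; have [//|//] := no_2p2 zx wy.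
Qed.

Lemma downset_scattered_representable :
  scattered (range (@downset d P)) (@subset P) ->
  exists (d' : Order.disp_t) (C : orderType d'),
    scattered_poset C /\ interval_representable P C.
Proof.
move=> Dscat.
have nlt x y : downset x = downset y -> ~ x < y.
  by move=> Dxy xy; have : downset y x := xy; rewrite -Dxy /downset /= ltxx.
have fiber_finite X : finite_set [set x : P | downset x = X].
  apply: antichain_finite => x y /= Dx Dy /negPf xy; rewrite /Order.comparable !le_eqVlt.
  rewrite (eq_sym y) xy /= negb_or; apply/andP.
  by split; apply/negP/nlt; rewrite Dx Dy.
have /choice[h hinj] X : exists h : P -> nat, forall x y,
    downset x = X -> downset y = X -> h x = h y -> x = y.
  have /countable_injP[h hinj] := finite_set_countable (fiber_finite X).
  by exists h => x y Dx Dy; apply: hinj; rewrite inE.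
pose n x := h (downset x) x.
pose le x y := `[< downset x `<=` downset y /\
                   (downset x = downset y -> (n x <= n y)%N) >].
have le_anti : antisymmetric le.
  move=> x y /andP[/asboolP[xy nxy] /asboolP[yx nyx]].
  have Dxy : downset x = downset y by apply/seteqP.
  apply: (hinj _ _ _ Dxy erefl); apply/eqP; rewrite eqn_leq.
  by move: (nxy Dxy) (nyx (esym Dxy)); rewrite /n Dxy => -> ->.
have le_trans : transitive le.
  move=> y x z /asboolP[xy nxy] /asboolP[yz nyz]; apply/asboolP; split.
    exact: subset_trans xy yz.
  move=> Dxz; have Dxy : downset x = downset y by apply/seteqP; rewrite Dxz in xy *.
  by apply: leq_trans (nxy Dxy) (nyz _); rewrite -Dxy.
have le_total : total le.
  move=> x y; case: (pselect (downset x = downset y)) => [Dxy|Dxy].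
    by have [nxy|nyx] := leqP (n x) (n y); apply/orP; [left|right];
      apply/asboolP; rewrite Dxy; split=> // _; exact: ltnW.
  have [xy|yx] := downset_total x y; apply/orP; [left|right]; apply/asboolP; split=> //.
  by move/esym.
pose C : orderType (Order.Disp tt tt) := ordered_by le_anti le_trans le_total.
have leC (x y : C) : x <= y -> downset (x : P) `<=` downset (y : P).
  by move=> /asboolP[].
exists _, C; split.
  move=> /embeds_rat_strict[f [_ flt]].
  have fle p q : p <= q -> downset (f p : P) `<=` downset (f q : P).
    by rewrite le_eqVlt => /orP[/eqP ->//|/flt[/leC]].
  (* Either the down-sets are pairwise distinct and give a copy of the rationals among down-sets, or
     two coincide and everything between them falls in one finite fiber. *)
  have [fneq|] := pselect (forall p q, p < q -> downset (f p : P) <> downset (f q : P)).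
    apply: Dscat; apply: (@strict_embeds_rat _ _ _ (fun q => downset (f q : P))) => [? _ //|q|p q pq].
      by exists (f q).
    split; first exact/fle/ltW.
    by move=> qp; apply: (fneq p q pq); apply/seteqP; split=> //; exact/fle/ltW.
  move=> /existsNP[p /existsNP[q /not_implyP[pq /contrapT Dpq]]].
  have [g gitv ghomo] := rat_embeds_itv pq.
  have finj : injective (f \o g : rat -> P).
    move=> s t /= fst; have [/ghomo/flt[_]|/ghomo/flt[_]|//] := ltgtP s t; by rewrite fst.
  apply: infinite_nat.
  have := fiber_finite (downset (f p : P)).
  move/(finite_preimage (f := fun m : nat => f (g m%:R%R) : P) _).
  suff -> : (fun m : nat => f (g m%:R%R) : P) @^-1` [set x | downset x = downset (f p : P)] = setT.
    by apply=> i j _ _ /finj/eqP; rewrite eqr_nat => /eqP.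
  apply/seteqP; split=> // m _ /=; have /andP[pg gq] := gitv m%:R%R.
  by apply/seteqP; split; [rewrite Dpq|]; exact: fle.
pose I (x : P) : set C := [set c : C | ((x : C) <= c) /\ ~ (x < (c : P))].
have Ixx x : I x x by rewrite /I /=; split; rewrite ?lexx// ltxx.
exists (range I); split.
  move=> _ [x _ <-]; split; first by exists x.
  move=> a b [xa _] [_ xb] c /andP[ac cb]; split; first exact: le_trans xa ac.
  by move=> xc; apply: xb; apply: (leC c b cb).
exists I; split; first split.
- by move=> x _; exists x.
- move=> x y _ _ Ixy; apply/(@le_anti x y)/andP; split.
    by have [] : I x y by rewrite Ixy; exact: Ixx.
  by have [] : I y x by rewrite -Ixy; exact: Ixx.
- by [].
move=> x y; split=> [xy a b [_ xa] [yb _]|Ixy].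
  (* Down-sets grow along [C], so being above [x] in [P] passes from [y] to [b], and would pass on
     to [a] if [b <= a]. *)
  have xb : x < (b : P) := leC y b yb x xy.
  rewrite ltNge; apply/negP => ba; apply: xa; exact: (leC b a ba).
(* Comparing the least elements gives [x <= y] in [C]; without [x < y] in [P], [y] then lies in both
   intervals. *)
apply: contrapT => nxy; have := Ixy x y (Ixx x) (Ixx y); rewrite lt_leAnge => /andP[xy _].
by have := Ixy y y _ (Ixx y); rewrite ltxx => /(_ _)/notF; apply; split.
Qed.

End IntervalOrder.

(** If both conclusions fail, the witnessing points satisfy [a < e <= c < b <= a]. *)
Lemma interval_order_no_2p2 (d : Order.disp_t) (P : porderType d) :
  interval_order P ->
  forall x y z w : P, x < z -> w < y -> x < y \/ w < z.
Proof.
move=> [d' [C [S [_ [I [_ Ilt]]]]]] x y z w /Ilt xz /Ilt wy.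
apply: contrapT => /not_orP[].
move=> /Ilt/existsNP[a /existsNP[b /not_implyP[xa /not_implyP[yb ab]]]].
move=> /Ilt/existsNP[c /existsNP[e /not_implyP[wc /not_implyP[ze ce]]]].
have := lt_trans (xz _ _ xa ze) (le_lt_trans _ (wy _ _ wc yb)).
by move: ab ce => /negP + /negP; rewrite -!leNgt => ba ec /(_ ec) /(le_lt_trans ba); rewrite ltxx.
Qed.

Theorem theorem1p3 (d : Order.disp_t) (P : porderType d)
    (P_interval : interval_order P)
    (P_no_infinite_antichain :
       forall A : set P, antichain A -> finite_set A) :
  [<-> scattered_poset P;
       scattered (AM P) (@AM_le d P);
       scattered (range (@upset d P)) (@subset P);
       scattered (range (@downset d P)) (@subset P);
       exists (d' : Order.disp_t) (C : orderType d'),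
         scattered_poset C /\ interval_representable P C].
Proof.
have no_2p2 := interval_order_no_2p2 P_interval.
tfae.
- exact: poset_scattered_AM.
- exact: AM_scattered_upset.
- exact: upset_scattered_downset.
- exact: downset_scattered_representable.
- by move=> [d' [C [Cscat Crep]]]; exact: interval_representable_scattered Crep.
Qed.
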